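(* Let $1\le K\le N$ be integers. An urn contains $N$ objects, of which $K$ are good and $N-K$ are bad, and objects are drawn one at a time, uniformly at random and without replacement. Let $P(n)$ denote the probability that the first good object is obtained exactly at the $n$-th draw. Then for every $n\in\{1,2,\ldots,N-K+1\}$, $$P(n)=\mathrm{Fail}(n-1)\,\frac{K}{N-n+1}=\frac{\binom{N-n+1}{K}}{\binom{N}{K}}\cdot\frac{K}{N-n+1}.$$
   Context: For given integers $N,K$, the Fail-function is $\mathrm{Fail}(n)=\binom{N-n}{K}\big/\binom{N}{K}$. Drawing uniformly at random without replacement means that at each step, each object remaining in the urn is equally likely to be drawn regardless of the history, and drawn objects are not put back. *)

(* Defs.v *)
From HB Require Import structures.
From mathcomp Require Import all_boot all_order all_algebra.
From mathcomp Require Import all_classical all_reals all_analysis.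

Set Implicit Arguments.
Unset Strict Implicit.
Unset Printing Implicit Defensive.

Import Order.TTheory GRing.Theory Num.Theory.

Local Open Scope classical_set_scope.
Local Open Scope ring_scope.

(* Meant for [n <= N]; beyond that the subtraction on nat is truncated. *)
Definition Fail (R : realType) (N K n : nat) : R :=
  'C(N - n, K)%:R / 'C(N, K)%:R.

Definition cond_prob (d : measure_display) (T : measurableType d)
    (R : realType) (P : probability T R) (A B : set T) : R :=
  fine (P (A `&` B)) / fine (P B).

Definition remaining (U : finType) (h : seq U) : {set U} :=
  [set x | x \notin h]%SET.

(* [X w] is the sequence of the [N] draws from the urn [U], in order. Given
   any history [h] of positive probability, the next draw is uniform on the
   objects not in [h]; in particular an object of [h] has conditional
   probability 0 of being drawn again. *)
Definition uniform_draws_without_replacement (d : measure_display)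
    (T : measurableType d) (R : realType) (P : probability T R)
    (U : finType) (N : nat) (X : T -> N.-tuple U) : Prop :=
  (forall t : N.-tuple U, measurable (X @^-1` [set t])) /\
  (forall (i : 'I_N) (h : i.-tuple U),
     let history := [set w | take i (X w) = h :> seq U] in
     (0 < P history)%E ->
     forall x : U,
       cond_prob P [set w | tnth (X w) i = x] history =
       if x \in remaining h then #|remaining h|%:R^-1 else 0).

(* Draws are numbered from 1. If no draw is good, the value is [N.+1]. *)
Definition first_good (U : finType) (N : nat) (G : {set U})
    (t : N.-tuple U) : nat :=
  (find (fun x => x \in G) t).+1.

(* Main.v *)
Require Import Defs.
From HB Require Import structures.
From mathcomp Require Import all_boot all_order all_algebra.
From mathcomp Require Import all_classical all_reals all_analysis.

Import Order.TTheory GRing.Theory Num.Theory.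

Local Open Scope classical_set_scope.
Local Open Scope ring_scope.

(** The law of the draws is a finite mass function [q] on the sequences
    [t : N.-tuple U], so every probability in play is a finite sum of values
    of [q].

    A history of positive mass has no repetition ([uniq_history]): prolonging
    it by one of its own objects has conditional probability 0.  Hence, after
    [i] bad draws, exactly [N - i] objects remain, all [K] good ones among
    them, whatever those draws were.  The next draw is therefore good with
    conditional probability [K / (N - i)] and bad with conditional probability
    [(N - i - K) / (N - i)]; summing over the bad histories of length [i]
    ([mass_all_bad_next]) gives these as the conditional probabilities given
    that the first [i] draws are bad.

    The bad case turns the probability of [i] bad draws into a product that
    satisfies the recursion of [Fail], since
    [(N - i) * 'C(N - i - 1, K) = (N - i - K) * 'C(N - i, K)]; so that
    probability is [Fail i] ([mass_all_bad]).  The good case with [i = n - 1]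
    then yields the theorem. *)

Set Implicit Arguments.
Unset Strict Implicit.

Section DrawLaw.

Variables (R : realType) (U : finType) (N : nat) (q : N.-tuple U -> R).

Definition mass (E : pred (N.-tuple U)) : R := \sum_(t | E t) q t.

(** The finite counterpart of [uniform_draws_without_replacement], with the
    conditional probability multiplied out. *)
Definition uniform_law :=
  forall (i : 'I_N) (h : i.-tuple U),
    let history := fun t : N.-tuple U => take i t == h :> seq U in
    0 < mass history ->
    forall x : U,
      mass (fun t => (tnth t i == x) && history t) =
      (if x \in remaining h then #|remaining h|%:R^-1 else 0) * mass history.

Hypotheses (q_ge0 : forall t, 0 <= q t) (q_unif : uniform_law).

Let history (i : nat) (h : seq U) (t : N.-tuple U) := take i t == h.

Lemma mass_ge0 E : 0 <= mass E.
Proof. exact: sumr_ge0. Qed.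

Lemma mass_sub (E F : pred (N.-tuple U)) :
  (forall t, E t -> F t) -> mass E <= mass F.
Proof.
move=> EF; rewrite /mass big_mkcond [leRHS]big_mkcond /=.
apply: ler_sum => t _; case: ifP => [/EF ->//|_].
by case: ifP.
Qed.

Lemma take_ordS (i : 'I_N) (t : N.-tuple U) :
  take i.+1 t = rcons (take i t) (tnth t i).
Proof. by rewrite (tnth_nth (tnth t i)) -take_nth // size_tuple. Qed.

(** The conditional probability that the next draw lies in [S] is the
    proportion of [S] among the remaining objects. *)
Lemma mass_next_in (i : 'I_N) (h : i.-tuple U) (S : {set U}) :
  mass (fun t => (tnth t i \in S) && history i h t) =
  #|(S :&: remaining h)%SET|%:R / #|remaining h|%:R * mass (history i h).
Proof.
(* Given a null history nothing is known of the next draw, but both sides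
   vanish. *)
have [h0|hn0] := eqVneq (mass (history i h)) 0.
  rewrite h0 mulr0; apply/eqP; rewrite eq_le mass_ge0 andbT -h0.
  by apply: mass_sub => t /andP[].
have hpos : 0 < mass (history i h) by rewrite lt_neqAle eq_sym hn0 mass_ge0.
rewrite /mass (partition_big (fun t => tnth t i) (mem S)) /=; last first.
  by move=> t /andP[].
transitivity (\sum_(x in S) (if x \in remaining h then #|remaining h|%:R^-1
                            else 0) * mass (history i h)).
  apply: eq_bigr => x xS; rewrite -(q_unif hpos x) /mass.
  apply: eq_bigl => t; have [->|_] := eqVneq (tnth t i) x.
    by rewrite xS andbT.
  by rewrite andbF.
rewrite -mulr_suml -big_mkcondr /=; congr (_ * _).
under eq_bigl do rewrite -finset.in_setI.
by rewrite sumr_const mulr_natl.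
Qed.

(** A prefix of a history of positive mass has positive mass, hence no
    repetition by induction; the last object cannot lie in that prefix, as
    drawing it again has probability 0. *)
Lemma uniq_history (i : nat) (h : seq U) :
  (i <= N)%N -> size h = i -> 0 < mass (history i h) -> uniq h.
Proof.
elim: i h => [|i IH] h iN; first by move/size0nil => ->.
case/lastP: h => // h x; rewrite size_rcons => -[szh] hpos.
pose io := Ordinal iN.
have hE t : history i.+1 (rcons h x) t = (tnth t io == x) && history i h t.
  by rewrite /history (take_ordS io) eqseq_rcons andbC.
have h'pos : 0 < mass (history i h).
  by apply: lt_le_trans hpos _; apply: mass_sub => t; rewrite hE => /andP[].
rewrite rcons_uniq IH ?(ltnW iN) // andbT.
have szh' : size h == io by apply/eqP.
have := q_unif (i := io) (h := Tuple szh') h'pos x.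
rewrite inE /=; case: ifP => // _; rewrite mul0r => m0.
move: hpos; rewrite /mass.
by under eq_bigl do rewrite hE; rewrite [X in 0 < X]m0 ltxx.
Qed.

Variables (K : nat) (G : {set U}).
Hypotheses (cardU : #|U| = N) (cardG : #|G| = K).
Hypothesis mass1 : mass xpredT = 1.

Definition all_bad (i : nat) (t : N.-tuple U) :=
  ~~ has (fun x => x \in G) (take i t).

Lemma card_remaining (h : seq U) :
  uniq h -> #|remaining h| = (N - size h)%N.
Proof.
move=> uh; rewrite -cardU -(card_uniqP uh) -(cardC (mem h)) addKn.
by apply: eq_card => x; rewrite !inE.
Qed.

Lemma good_remaining (h : seq U) :
  ~~ has (fun x => x \in G) h -> G \subset remaining h.
Proof.
move/hasPn => hG; apply/fintype.subsetP => x xG; rewrite inE.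
by apply: contraL xG => /hG.
Qed.

(** [c] is the same for all bad histories of length [i], so it factors out of
    the sum over them; the possibly repetitive ones contribute nothing. *)
Lemma mass_all_bad_next (i : 'I_N) (S : {set U}) (c : nat) :
  (forall h : i.-tuple U, uniq h -> ~~ has (fun x => x \in G) h ->
     #|(S :&: remaining h)%SET| = c) ->
  mass (fun t => (tnth t i \in S) && all_bad i t) =
  c%:R / (N - i)%:R * mass (all_bad i).
Proof.
move=> cS.
have mi : minn i N = i by apply/minn_idPl/ltnW.
pose pre (t : N.-tuple U) : i.-tuple U := tcast mi [tuple of take i t].
have preE (t : N.-tuple U) h : (pre t == h) = history i h t.
  by rewrite -val_eqE /= val_tcast.
pose bad (h : i.-tuple U) := ~~ has (fun x => x \in G) h.
have split_history (E : pred (N.-tuple U)) :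
    mass (fun t => E t && all_bad i t) =
    \sum_(h | bad h) mass (fun t => E t && history i h t).
  rewrite /mass (partition_big pre bad) /=; last first.
    by move=> t /andP[_]; rewrite /bad val_tcast.
  apply: eq_bigr => h badh; apply: eq_bigl => t; rewrite preE.
  rewrite -andbA; congr (_ && _); apply/andP/idP => [[]//|ht]; split=> //.
  by rewrite /all_bad (eqP ht).
rewrite split_history (split_history xpredT) mulr_sumr.
apply: eq_bigr => h badh; rewrite mass_next_in /=.
have [->|hn0] := eqVneq (mass (history i h)) 0; first by rewrite !mulr0.
have uh : uniq h.
  apply: (@uniq_history i); rewrite ?size_tuple ?(ltnW (ltn_ord i)) //.
  by rewrite lt_neqAle eq_sym hn0 mass_ge0.
by rewrite cS // card_remaining // size_tuple.
Qed.

Lemma mass_all_bad_good (i : 'I_N) :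
  mass (fun t => (tnth t i \in G) && all_bad i t) =
  K%:R / (N - i)%:R * mass (all_bad i).
Proof.
apply: mass_all_bad_next => h _ badh.
by rewrite (finset.setIidPl (good_remaining badh)).
Qed.

Lemma mass_all_badS (i : 'I_N) :
  mass (all_bad i.+1) = (N - i - K)%:R / (N - i)%:R * mass (all_bad i).
Proof.
rewrite -(@mass_all_bad_next i (~: G)%SET (N - i - K)); last first.
  move=> h uh badh; have := cardsID G (remaining h).
  rewrite card_remaining // size_tuple finset.setIC.
  rewrite (finset.setIidPl (good_remaining badh)) cardG => <-.
  by rewrite addKn finset.setDE finset.setIC.
apply: eq_bigl => t.
by rewrite /all_bad take_ordS has_rcons negb_or finset.in_setC.
Qed.

(** Both sides are 1 for [i = 0] and are multiplied by
    [(N - i - K) / (N - i)] when [i] grows by one. *)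
Lemma mass_all_bad (i : nat) :
  (K <= N)%N -> (i <= N)%N -> mass (all_bad i) = Fail R N K i.
Proof.
move=> KN; elim: i => [|i IH] iN.
  rewrite /Fail subn0 divff ?pnatr_eq0 -?lt0n ?bin_gt0 // -mass1.
  by apply: eq_bigl => t; rewrite /all_bad take0.
have Ni : (0 < N - i)%N by rewrite subn_gt0.
rewrite (mass_all_badS (Ordinal iN)) IH ?(ltnW iN) //= /Fail mulrA.
congr (_ / _).
have Ni0 : (N - i)%:R != 0 :> R by rewrite pnatr_eq0 -lt0n.
apply: (mulfI Ni0).
rewrite mulrA mulrCA divff // mulr1 -!natrM; congr (_%:R).
by rewrite subnS mul_bin_down.
Qed.

Lemma first_good_eq (i : 'I_N) (t : N.-tuple U) :
  (first_good G t == i.+1) = (tnth t i \in G) && all_bad i t.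
Proof.
pose x0 := tnth t i; have it : (i < size t)%N by rewrite size_tuple.
rewrite /first_good eqSS /all_bad has_take_leq ?(ltnW it) // -leqNgt.
rewrite (tnth_nth x0).
apply/eqP/andP => [fi|[ti fge]].
  rewrite -fi leqnn; split=> //.
  by apply: (@nth_find _ x0 (fun x => x \in G)); rewrite has_find fi.
apply/eqP; rewrite eqn_leq fge andbT leqNgt; apply/negP => lt_if.
by have := @before_find _ x0 (fun x => x \in G) t i lt_if; rewrite ti.
Qed.

End DrawLaw.

(** An event that depends only on the draws is a finite disjoint union of the
    events [X @^-1` [set t]]. *)
Lemma probability_mass (R : realType) (d : measure_display)
    (T : measurableType d) (P : probability T R) (U : finType) (N : nat)
    (X : T -> N.-tuple U)
    (mX : forall t : N.-tuple U, measurable (X @^-1` [set t]))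
    (E : pred (N.-tuple U)) :
  P [set w | E (X w)] = (mass (fun t => fine (P (X @^-1` [set t]))) E)%:E.
Proof.
have -> : [set w | E (X w)] = \bigcup_(t in [set` enum E]) X @^-1` [set t].
  apply/seteqP; split => w /=; first by exists (X w); rewrite //= mem_enum.
  by move=> [t /= +  ->]; rewrite mem_enum.
rewrite measure_fin_bigcup //; last first.
  by move=> s t _ _ [w [/= <- <-]].
rewrite -fsbig_seq ?enum_uniq // big_enum /mass -sumEFin.
apply: eq_bigr => t _.
by rewrite fineK // fin_num_measure.
Qed.

Unset Implicit Arguments.
Set Strict Implicit.

Theorem theorem2p3 (R : realType) (N K : nat) (hK : (1 <= K)%N)
    (hKN : (K <= N)%N)
    (U : finType) (G : {set U}) (cardU : #|U| = N) (cardG : #|G| = K)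
    (d : measure_display) (T : measurableType d) (P : probability T R)
    (X : T -> N.-tuple U)
    (hX : uniform_draws_without_replacement P X)
    (n : nat) (hn1 : (1 <= n)%N) (hnN : (n <= N - K + 1)%N) :
  P [set w | first_good G (X w) = n] =
    (Fail R N K (n - 1) * (K%:R / (N - n + 1)%:R))%:E /\
  Fail R N K (n - 1) * (K%:R / (N - n + 1)%:R) =
    'C(N - n + 1, K)%:R / 'C(N, K)%:R * (K%:R / (N - n + 1)%:R).
Proof.
case: hX => mX unifX.
pose q t := fine (P (X @^-1` [set t])).
have lawX (E : pred (N.-tuple U)) : P [set w | E (X w)] = (mass q E)%:E
    by exact: probability_mass.
have q_ge0 t : 0 <= q t by rewrite fine_ge0.
have q1 : mass q xpredT = 1.
  apply: EFin_inj; rewrite -(lawX xpredT) -(probability_setT P); congr (P _).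
  exact/seteqP.
have q_unif : uniform_law q.
  move=> i h history hpos x.
  have histE : [set w | take i (X w) = h :> seq U] = [set w | history (X w)].
    by apply/seteqP; split => w /= /eqP.
  have := unifX i h; rewrite /= histE (lawX history) lte_fin => /(_ hpos x) <-.
  rewrite /cond_prob (lawX history).
  have -> : [set w | tnth (X w) i = x] `&` [set w | history (X w)] =
            [set w | (tnth (X w) i == x) && history (X w)].
    apply/seteqP; split => w /=; first by move=> [-> ->]; rewrite eqxx.
    by move=> /andP[/eqP ? ?].
  by rewrite (lawX (fun t => (tnth t i == x) && history t)) /= divfK ?gt_eqF.
case: n hn1 hnN => // n _; rewrite addn1 ltnS => nNK.
have nN : (n < N)%N by apply: (leq_ltn_trans nNK); rewrite ltn_subrL hK (leq_trans hK).
have -> : (N - n.+1 + 1 = N - n)%N by rewrite addn1 subnSK.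
rewrite subn1 /=; split=> //.
pose i := Ordinal nN.
have -> : [set w | first_good G (X w) = n.+1] =
          [set w | (tnth (X w) i \in G) && all_bad G n (X w)].
  by apply/seteqP; split => w /=; rewrite -(first_good_eq _ i) => /eqP.
rewrite (lawX (fun t => (tnth t i \in G) && all_bad G n t)).
rewrite (mass_all_bad_good q_ge0 q_unif cardU cardG).
by rewrite (mass_all_bad q_ge0 q_unif cardU cardG q1) // 1?mulrC // ltnW.
Qed.
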